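(* Let $(\mathcal{N},\mathcal{I})$ be a $k$-extendible system with rank $r$ on a ground set of size $n$, let $f:2^{\mathcal{N}}\to\mathbb{R}_{\ge 0}$ be non-negative submodular, and run the algorithm SimultaneousGreedys with $\ell=k+1$ solutions. Then the algorithm makes $O(k^2 r n)$ calls to the value and independence oracles and outputs an independent set $S$ with $f(S)\ge \frac{k}{(k+1)^2} f(OPT)$, i.e., its approximation ratio is at most $(k+1)^2/k = k+O(1)$. Moreover, when $f$ is non-negative monotone submodular, the approximation ratio improves to $k+1$, i.e., $f(S)\ge f(OPT)/(k+1)$.
   Context: $\mathcal{N}$ is a finite ground set of size $n$. A set function $f$ is submodular if $f(X\cup Y)+f(X\cap Y)\le f(X)+f(Y)$ for all $X,Y\subseteq\mathcal{N}$, and monotone if $f(A)\le f(B)$ for $A\subseteq B$; write $f(u\mid S)=f(S\cup\{u\})-f(S)$ and $S+u=S\cup\{u\}$. An independence system $(\mathcal{N},\mathcal{I})$ is a non-empty family $\mathcal{I}\subseteq 2^{\mathcal{N}}$ closed under taking subsets. It is $k$-extendible if for all independent $A\subseteq B\in\mathcal{I}$ and $u\notin B$ with $A+u\in\mathcal{I}$ there is $Y\subseteq B\setminus A$ with $|Y|\le k$ and $(B\setminus Y)\cup\{u\}\in\mathcal{I}$. The rank $r$ is the maximum size of an independent set. It is assumed that $\{u\}\in\mathcal{I}$ for every $u\in\mathcal{N}$. $OPT$ denotes a set in $\mathcal{I}$ maximizing $f$. The algorithm accesses $f$ only through a value oracle (returns $f(S)$) and $\mathcal{I}$ only through an independence oracle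 (decides whether $S\in\mathcal{I}$). SimultaneousGreedys$(\mathcal{N},f,\mathcal{I},\ell)$: initialize $S^{(j)}_0=\varnothing$ for $j=1,\dots,\ell$ and $\mathcal{N}_0=\mathcal{N}$. At iteration $i=1,2,\dots$, let $\mathcal{A}_i$ be the set of pairs $(u,j)$ with $u\in\mathcal{N}_{i-1}$, $j\in\{1,\dots,\ell\}$, $S^{(j)}_{i-1}+u\in\mathcal{I}$ and $f(u\mid S^{(j)}_{i-1})>0$. If $\mathcal{A}_i=\varnothing$, stop. Otherwise choose $(u_i,j_i)\in\mathcal{A}_i$ maximizing $f(u\mid S^{(j)}_{i-1})$, set $S^{(j_i)}_i=S^{(j_i)}_{i-1}+u_i$, $S^{(j)}_i=S^{(j)}_{i-1}$ for $j\ne j_i$, and $\mathcal{N}_i=\mathcal{N}_{i-1}-u_i$. On termination, output the set maximizing $f$ among the $\ell$ final solutions. *)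

(* Defs.v *)
From HB Require Import structures.
From mathcomp Require Import all_boot all_order all_algebra.

Set Implicit Arguments.
Unset Strict Implicit.
Unset Printing Implicit Defensive.

Import Order.TTheory GRing.Theory Num.Theory.
Local Open Scope ring_scope.

Definition nonnegative (R : realFieldType) (T : finType) (f : {set T} -> R) :=
  forall A, 0 <= f A.

Definition submodular (R : realFieldType) (T : finType) (f : {set T} -> R) :=
  forall A B, f (A :|: B) + f (A :&: B) <= f A + f B.

Definition monotone (R : realFieldType) (T : finType) (f : {set T} -> R) :=
  forall A B : {set T}, A \subset B -> f A <= f B.

Definition independence_system (T : finType) (I : {set {set T}}) :=
  I != set0 /\ forall A B : {set T}, A \subset B -> B \in I -> A \in I.

Definition k_extendible (T : finType) (k : nat) (I : {set {set T}}) :=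
  independence_system I /\
  forall (A B : {set T}) (u : T),
    A \subset B -> B \in I -> u \notin B -> u |: A \in I ->
    exists Y : {set T},
      [/\ Y \subset B :\: A, (#|Y| <= k)%N & u |: (B :\: Y) \in I].

Definition rank (T : finType) (I : {set {set T}}) : nat :=
  \max_(A in I) #|A|.

Definition is_opt (R : realFieldType) (T : finType) (f : {set T} -> R)
    (I : {set {set T}}) (OPT : {set T}) :=
  OPT \in I /\ forall A, A \in I -> f A <= f OPT.

(** A program cannot mention f or I: it learns about them only through the
    queries [AskValue] and [AskIndep]. [Choose s q] picks an arbitrary member
    of s; it models unspecified tie-breaking and costs no oracle call. *)

Inductive prog (R : Type) (T : finType) (A : Type) : Type :=
| Ret of A
| AskValue of {set T} & (R -> prog R T A)
| AskIndep of {set T} & (bool -> prog R T A)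
| Choose (B : eqType) of seq B & (B -> prog R T A).

Arguments Ret {R T A}.
Arguments AskValue {R T A}.
Arguments AskIndep {R T A}.
Arguments Choose {R T A B}.

Fixpoint bind (R : Type) (T : finType) (A B : Type)
    (p : prog R T A) (g : A -> prog R T B) : prog R T B :=
  match p with
  | Ret a => g a
  | AskValue X q => AskValue X (fun v => bind (q v) g)
  | AskIndep X q => AskIndep X (fun b => bind (q b) g)
  | Choose _ s q => Choose s (fun b => bind (q b) g)
  end.

(** [exec f I p c a]: when the oracles answer according to f and I, the program
    p can (for some resolution of its choices) return a after exactly c calls. *)
Fixpoint exec (R : Type) (T : finType) (f : {set T} -> R) (I : {set {set T}})
    (A : Type) (p : prog R T A) (c : nat) (a : A) : Prop :=
  match p with
  | Ret b => c = 0%N /\ a = b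
  | AskValue X q => exists2 c', c = c'.+1 & exec f I (q (f X)) c' a
  | AskIndep X q => exists2 c', c = c'.+1 & exec f I (q (X \in I)) c' a
  | Choose _ s q => exists2 b, b \in s & exec f I (q b) c a
  end.

Fixpoint collect (R : Type) (T : finType) (B : Type)
    (q : B -> prog R T (option R)) (s : seq B) : prog R T (seq (B * R)) :=
  if s is b :: s' then
    bind (q b) (fun o =>
    bind (collect q s') (fun l =>
    Ret (if o is Some v then (b, v) :: l else l)))
  else Ret [::].

Definition maximizers (R : realFieldType) (B : Type) (l : seq (B * R)) : seq B :=
  [seq x.1 | x <- l & all (fun y : B * R => y.2 <= x.2) l].

(** The marginal gain f(u | S), if S + u is independent and this gain is
    positive. *)
Definition gain (R : realFieldType) (T : finType) (S : {set T}) (u : T) :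
    prog R T (option R) :=
  AskIndep (u |: S) (fun b =>
    if b then
      AskValue (u |: S) (fun v => AskValue S (fun w =>
        Ret (if 0 < v - w then Some (v - w) else None)))
    else Ret None).

(** N is the set of remaining elements, S j the j-th current solution. Each
    iteration removes an element from N, so [#|N|] is always enough fuel:
    when the fuel runs out N is empty and no pair is eligible any more. *)
Fixpoint greedy_loop (R : realFieldType) (T : finType) (l : nat) (fuel : nat)
    (N : {set T}) (S : {ffun 'I_l -> {set T}}) :
    prog R T {ffun 'I_l -> {set T}} :=
  if fuel is fuel'.+1 then
    bind (collect (fun x : T * 'I_l => gain R (S x.2) x.1)
            [seq (u, j) | u <- enum N, j <- enum 'I_l])
      (fun cands =>
        if cands is [::] then Ret S
        else Choose (maximizers cands) (fun x : T * 'I_l =>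
          greedy_loop R fuel' (N :\ x.1)
            [ffun j => if j == x.2 then x.1 |: S j else S j]))
  else Ret S.

Definition simultaneous_greedys (R : realFieldType) (T : finType) (l : nat) :
    prog R T {set T} :=
  bind (greedy_loop R #|T| [set: T] [ffun _ : 'I_l => set0]) (fun S =>
  bind (collect (fun j => AskValue (S j) (fun v => Ret (Some v))) (enum 'I_l))
    (fun vals => Choose (maximizers vals) (fun j => Ret (S j)))).

(* Main.v *)
(** Let F_0, ..., F_k be the final solutions and O an optimal set. Each element of
    O outside F_j leaves the set of elements still addable to the j-th solution at
    some step, and its marginal on F_j is then at most the greedy gain of that
    step. Every step receives at most k such charges, so that, the gains adding
    up to the values f(F_j) - f(set0), submodularity gives
    \sum_j f(O U F_j) <= (k + 1) \sum_j f(F_j) <= (k + 1)^2 f(S).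
    The left-hand side is at least k f(O) because the F_j are disjoint, and at
    least (k + 1) f(O) when f is monotone. *)
Require Import Defs.
From HB Require Import structures.
From mathcomp Require Import all_boot all_order all_algebra.
From mathcomp Require Import zify ring lra.

Set Implicit Arguments.
Unset Strict Implicit.
Unset Printing Implicit Defensive.

Import Order.TTheory GRing.Theory Num.Theory.
Local Open Scope ring_scope.

(** * Costs and results of oracle programs *)

Section Programs.

Variables (R : realFieldType) (T : finType).
Variables (f : {set T} -> R) (I : {set {set T}}).

Lemma exec_bind (A B : Type) (p : prog R T A) (g : A -> prog R T B) c b :
  exec f I (bind p g) c b <->
  exists a c1 c2, [/\ c = (c1 + c2)%N, exec f I p c1 a & exec f I (g a) c2 b].
Proof.
elim: p c => [a|X q IH|X q IH|E s q IH] c /=.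
- split=> [gb|[a' [c1 [c2 [-> [-> ->] //]]]]].
  by exists a, 0%N, c.
- split=> [[c' -> /IH [a [c1 [c2 [-> pa gb]]]]]|[a [c1 [c2 [-> [c' -> pa] gb]]]]].
    by exists a, c1.+1, c2; split=> //; exists c1.
  by exists (c' + c2)%N => //; apply/IH; exists a, c', c2.
- split=> [[c' -> /IH [a [c1 [c2 [-> pa gb]]]]]|[a [c1 [c2 [-> [c' -> pa] gb]]]]].
    by exists a, c1.+1, c2; split=> //; exists c1.
  by exists (c' + c2)%N => //; apply/IH; exists a, c', c2.
- split=> [[e es /IH [a [c1 [c2 [-> pa gb]]]]]|[a [c1 [c2 [-> [e es pa] gb]]]]].
    by exists a, c1, c2; split=> //; exists e.
  by exists e => //; apply/IH; exists a, c1, c2.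
Qed.

(** The result is fixed but the cost only bounded: [gain] asks one query or three, depending on the
    independence answer. *)
Definition computes (A : Type) (p : prog R T A) (m : nat) (a : A) :=
  (exists c, exec f I p c a) /\
  (forall c b, exec f I p c b -> (c <= m)%N /\ b = a).

Lemma computes_ret (A : Type) (a : A) : computes (Ret a) 0 a.
Proof. by split=> [|c b [-> ->]]; [exists 0%N | ]. Qed.

Lemma computes_bind (A B : Type) (p : prog R T A) (g : A -> prog R T B) m n a b :
  computes p m a -> computes (g a) n b -> computes (bind p g) (m + n) b.
Proof.
move=> [[c1 pa] puniq] [[c2 gb] guniq]; split.
  by exists (c1 + c2)%N; apply/exec_bind; exists a, c1, c2.
move=> c b' /exec_bind [a' [d1 [d2 [-> /puniq [le1 ->] /guniq [le2 ->]]]]].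
by split=> //; apply: leq_add.
Qed.

Lemma computes_collect (B : Type) (q : B -> prog R T (option R)) m h s :
  (forall b, computes (q b) m (h b)) ->
  computes (collect q s) (m * size s)
    (pmap (fun b => omap (pair b) (h b)) s).
Proof.
move=> qh; elim: s => [|b s IH] /=; first by rewrite muln0; apply: computes_ret.
rewrite mulnS; apply: computes_bind (qh b) _.
rewrite -[(m * _)%N]addn0; apply: computes_bind IH _.
by case: (h b) => [v|]; apply: computes_ret.
Qed.

Definition positive_gain (S : {set T}) (u : T) : option R :=
  if (u |: S \in I) && (0 < f (u |: S) - f S) then Some (f (u |: S) - f S)
  else None.

Lemma computes_gain (S : {set T}) (u : T) :
  computes (gain R S u) 3 (positive_gain S u).
Proof.
rewrite /gain /positive_gain; split.
  case uSI: (u |: S \in I) => /=.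
    by exists 3%N; exists 2%N => //; rewrite uSI; exists 1%N => //; exists 0%N.
  by exists 1%N; exists 0%N; rewrite ?uSI.
move=> c b /= [c' ->]; case: (u |: S \in I) => /=; last by case=> -> ->.
by case=> c1 -> [c2 -> [-> ->]].
Qed.

Lemma mem_maximizers (B : eqType) (l : seq (B * R)) (x : B) :
  x \in maximizers l ->
  exists2 v, (x, v) \in l & forall y, y \in l -> y.2 <= v.
Proof.
case/mapP=> -[y v]; rewrite mem_filter /= => /andP[/allP lev yl ->].
by exists v.
Qed.

(** Needed for existence of executions, since [exec] cannot pass a [Choose] from an empty list. *)
Lemma maximizers_neq_nil (B : eqType) (l : seq (B * R)) :
  l != [::] -> exists x, x \in maximizers l.
Proof.
move=> l0; suff [x xl xmax] : exists2 x, x \in l & all (fun y => y.2 <= x.2) l.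
  by exists x.1; apply/map_f; rewrite mem_filter xmax.
elim: l l0 => // z [|z' l] IH _.
  by exists z; rewrite ?mem_head //= lexx.
have [//|x xl xmax] := IH; have [le_xz|lt_zx] := leP x.2 z.2.
  exists z; first exact: mem_head.
  apply/allP=> y; rewrite in_cons => /predU1P[-> //|/(allP xmax) le_yx].
  exact: le_trans le_yx le_xz.
exists x; first by rewrite in_cons xl orbT.
by apply/allP=> y; rewrite in_cons => /predU1P[->|/(allP xmax) //]; apply: ltW.
Qed.

End Programs.

(** * Oracle-free greedy runs and their invariants *)

Section GreedyRuns.

Variables (R : realFieldType) (T : finType).
Variables (f : {set T} -> R) (I : {set {set T}}) (l : nat).

Implicit Types (N O : {set T}) (S F D : {ffun 'I_l -> {set T}}).

Definition add_to S (u : T) (j : 'I_l) : {ffun 'I_l -> {set T}} :=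
  [ffun i => if i == j then u |: S i else S i].

(** The trace of the loop without its queries, indexed by the number of additions. Maximality in
    [run_step] ranges over all addable pairs, not only those of positive gain; this is equivalent
    because the chosen gain is positive. *)
Inductive greedy_run : nat -> {set T} -> {ffun 'I_l -> {set T}} ->
    {ffun 'I_l -> {set T}} -> Prop :=
| run_stop N S :
    (forall u j, u \in N -> u |: S j \in I -> f (u |: S j) <= f (S j)) ->
    greedy_run 0 N S S
| run_step m N S F u j :
    u \in N -> u |: S j \in I -> 0 < f (u |: S j) - f (S j) ->
    (forall v i, v \in N -> v |: S i \in I ->
       f (v |: S i) - f (S i) <= f (u |: S j) - f (S j)) ->
    greedy_run m (N :\ u) (add_to S u j) F ->
    greedy_run m.+1 N S F.

Definition candidates N S : seq (T * 'I_l * R) :=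
  pmap (fun x => omap (pair x) (positive_gain f I (S x.2) x.1))
    [seq (u, j) | u <- enum N, j <- enum 'I_l].

Lemma mem_candidates N S u j v :
  ((u, j, v) \in candidates N S) =
  [&& u \in N, u |: S j \in I, 0 < f (u |: S j) - f (S j)
    & v == f (u |: S j) - f (S j)].
Proof.
rewrite /candidates mem_pmap; apply/mapP/and4P => [[[u' j'] /allpairsP[[w i]]]|].
  rewrite /= !mem_enum => -[wN _ [-> ->]]; rewrite /positive_gain.
  by case: ifP => //= /andP[wI w0] [-> -> ->].
case=> uN uI u0 /eqP ->; exists (u, j); last by rewrite /positive_gain /= uI u0.
by apply/allpairsP; exists (u, j); rewrite !mem_enum.
Qed.

Lemma computes_candidates N S :
  computes f I (collect (fun x : T * 'I_l => gain R (S x.2) x.1)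
    [seq (u, j) | u <- enum N, j <- enum 'I_l])
    (3 * (#|N| * l)) (candidates N S).
Proof.
have -> : (#|N| * l)%N = size [seq (u, j) | u <- enum N, j <- enum 'I_l].
  by rewrite size_allpairs -cardE size_enum_ord.
by apply: computes_collect => x; apply: computes_gain.
Qed.

Lemma exec_greedy_loop_exists fuel N S :
  exists c F, exec f I (greedy_loop R fuel N S) c F.
Proof.
elim: fuel N S => [|fuel IH] N S /=; first by exists 0%N, S.
have [[c1 cand] _] := computes_candidates N S.
case cE: (candidates N S) cand => [|x s] cand.
  exists (c1 + 0)%N, S; apply/exec_bind.
  by exists [::], c1, 0%N.
have [//|y ymax] := @maximizers_neq_nil R _ (x :: s).
have [c2 [F loopF]] := IH (N :\ y.1) (add_to S y.1 y.2).
exists (c1 + c2)%N, F; apply/exec_bind; exists (x :: s), c1, c2; split=> //.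
by exists y.
Qed.

(** A run of [m] additions scans the pairs at most [m.+1] times, the extra scan being the one that
    finds no candidate. *)
Lemma exec_greedy_loop_run fuel N S c F :
  (#|N| <= fuel)%N -> exec f I (greedy_loop R fuel N S) c F ->
  exists2 m, greedy_run m N S F & (c <= 3 * (#|T| * l) * m.+1)%N.
Proof.
elim: fuel N S c => [|fuel IH] N S c /=.
  (* Without fuel [N] is empty, so the stopping condition holds vacuously. *)
  rewrite leqn0 cards_eq0 => /eqP -> [-> ->]; exists 0%N => //.
  by apply: run_stop => u j; rewrite inE.
move=> leN /exec_bind [cand [c1 [c2 [-> c1P]]]].
have [le_c1 -> {c1P}] := (computes_candidates N S).2 _ _ c1P.
have {}le_c1 : (c1 <= 3 * (#|T| * l))%N.
  by apply: leq_trans le_c1 _; rewrite leq_mul2l leq_mul2r max_card orbT.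
case cE: (candidates N S) => [|x s] /=.
  case=> -> ->; exists 0%N; last by rewrite addn0 muln1.
  apply: run_stop => u j uN uI; rewrite leNgt -subr_gt0; apply/negP => u0.
  have := mem_candidates N S u j (f (u |: S j) - f (S j)).
  by rewrite uN uI u0 eqxx cE.
rewrite -{x s}cE => -[[u j] /mem_maximizers [v]].
rewrite mem_candidates => /and4P[uN uI u0 /eqP ->] umax /= loopF.
have [|m runF le_c2] := IH _ _ _ _ loopF.
  by move: leN; rewrite (cardsD1 u N) uN.
exists m.+1; last by rewrite mulnS leq_add.
(* A gain above that of [u] would be positive, hence listed among the candidates. *)
apply: run_step runF => // w i wN wI; rewrite leNgt; apply/negP => lt_w.
have /umax : (w, i, f (w |: S i) - f (S i)) \in candidates N S.
  by rewrite mem_candidates wN wI eqxx (lt_trans u0 lt_w).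
by rewrite leNgt lt_w.
Qed.

Lemma add_toE S u j i :
  add_to S u j i = if i == j then u |: S i else S i.
Proof. by rewrite ffunE. Qed.

Lemma sub_add_to S u j i : S i \subset add_to S u j i.
Proof. by rewrite add_toE; case: ifP => // _; apply: subsetUr. Qed.

Lemma add_to_disjoint N S u j :
  (forall i, [disjoint S i & N]) ->
  forall i, [disjoint add_to S u j i & N :\ u].
Proof.
move=> dSN i; rewrite -setI_eq0; apply/eqP/setP => x; rewrite add_toE !inE.
have /pred0P/(_ x) := dSN i; rewrite /= => dx.
case: ifP => _; rewrite ?inE; case: eqP => //= _; last by rewrite andbF.
Qed.

Lemma greedy_run_sub m N S F :
  greedy_run m N S F -> forall i, S i \subset F i.
Proof.
elim=> [*|{}m {}N {}S {}F u j _ _ _ _ _ IH i]; first exact: subxx.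
exact: subset_trans (sub_add_to S u j i) (IH i).
Qed.

(** Final solutions grow only from [N]; hence an element given to one solution never enters
    another. *)
Lemma greedy_run_subU m N S F :
  greedy_run m N S F -> forall i, F i \subset S i :|: N.
Proof.
elim=> [{}N {}S _ i|{}m {}N {}S {}F u j uN _ _ _ _ IH i]; first exact: subsetUl.
apply: subset_trans (IH i) _; rewrite add_toE; apply/subsetP=> x.
case: ifP => _; rewrite !inE; last by case/orP=> [->|/andP[_ ->]]; rewrite ?orbT.
by case/orP=> [/orP[/eqP ->|->]|/andP[_ ->]]; rewrite ?uN ?orbT.
Qed.

Lemma greedy_run_indep m N S F :
  greedy_run m N S F -> (forall i, S i \in I) -> forall i, F i \in I.
Proof.
elim=> [//|{}m {}N {}S {}F u j _ uI _ _ _ IH SI]; apply: IH => i.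
by rewrite add_toE; case: eqP => // ->.
Qed.

Lemma greedy_run_card m N S F :
  greedy_run m N S F -> (forall i, [disjoint S i & N]) ->
  (\sum_i #|F i| = m + \sum_i #|S i|)%N.
Proof.
elim=> [//|{}m {}N {}S {}F u j uN _ _ _ _ IH dSN].
rewrite IH; last exact: add_to_disjoint.
rewrite (bigD1 j) //= [in RHS](bigD1 j) //= add_toE eqxx cardsU1.
have -> : u \notin S j.
  by apply/negP => uS; have /pred0P/(_ u) := dSN j; rewrite /= uS uN.
rewrite (eq_bigr (fun i => #|S i|)) => [|i /negbTE ij]; last by rewrite add_toE ij.
by rewrite add1n !addnS !addSn.
Qed.

Lemma greedy_run_disjoint m N S F :
  greedy_run m N S F -> (forall i, [disjoint S i & N]) ->
  (forall i j, i != j -> [disjoint S i & S j]) ->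
  forall i j, i != j -> [disjoint F i & F j].
Proof.
elim=> [//|{}m {}N {}S {}F u j uN _ _ _ _ IH dSN dS]; apply: IH.
  exact: add_to_disjoint.
have uS i : u \notin S i.
  by apply/negP => uS; have /pred0P/(_ u) := dSN i; rewrite /= uS uN.
move=> a b ab; rewrite !add_toE; have := dS _ _ ab.
rewrite -!setI_eq0 => /eqP/setP dab; apply/eqP/setP => x; move: (dab x).
case: eqP => [aj|_]; case: eqP => [bj|_]; rewrite ?inE //.
- by move: ab; rewrite aj bj eqxx.
- by case: (x =P u) => // ->; rewrite (negbTE (uS b)).
- by case: (x =P u) => // ->; rewrite (negbTE (uS a)).
Qed.

End GreedyRuns.

(** * Consequences of submodularity *)

Section Submodular.

Variables (R : realFieldType) (T : finType) (f : {set T} -> R).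
Hypothesis fsub : submodular f.

(** Submodularity for [u |: A] and [B], whose union is [u |: B] and whose intersection is [A]. *)
Lemma submodular_marginal (A B : {set T}) u :
  A \subset B -> u \notin B -> f (u |: B) - f B <= f (u |: A) - f A.
Proof.
move=> AB uB; have := fsub (u |: A) B.
have -> : u |: A :|: B = u |: B by rewrite -setUA (setUidPr AB).
have -> : (u |: A) :&: B = A.
  rewrite setIUl (setIidPl AB); apply/setUidPr/subsetP => x.
  by rewrite !inE => /andP[/eqP -> uB']; rewrite uB' in uB.
lra.
Qed.

Lemma submodular_sum_marginals (O S : {set T}) :
  f (O :|: S) - f S <= \sum_(o in O :\: S) (f (o |: S) - f S).
Proof.
(* The elements of [O :\: S] are added one by one along a list; each marginal is at most the one on
   [S] alone. *)
suff H s : uniq s -> [disjoint [set x in s] & S] ->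
    f ([set x in s] :|: S) - f S <= \sum_(o <- s) (f (o |: S) - f S).
  have := H (enum (O :\: S)) (enum_uniq _).
  have -> : [set x in enum (O :\: S)] = O :\: S.
    by apply/setP => x; rewrite inE mem_enum.
  have -> : (O :\: S) :|: S = O :|: S.
    by apply/setP => x; rewrite !inE; case: (x \in S); rewrite ?orbT.
  rewrite big_enum /=; apply.
  by rewrite -setI_eq0 setIDAC setDIl setDv setI0.
elim: s => [|x s IH] /=; first by rewrite set_nil set0U big_nil subrr.
case/andP=> xs us; rewrite set_cons big_cons -setI_eq0 setIUl setU_eq0 !setI_eq0.
rewrite disjoints1 => /andP[xS ds]; have := IH us ds.
have /(submodular_marginal (subsetUr [set x in s] S)) : x \notin [set x in s] :|: S.
  by rewrite !inE negb_or xs.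
rewrite setUA; lra.
Qed.

(** By disjointness, [O :|: F j] meets the union of [O] with the other sets exactly in [O], so each
    application of submodularity releases one copy of [f O]. *)
Lemma submodular_disjoint_unions (J : eqType) (s : seq J) (F : J -> {set T}) O :
  (forall i j, i != j -> [disjoint F i & F j]) -> uniq s ->
  (size s)%:R * f O + f (O :|: \bigcup_(j <- s) F j)
    <= \sum_(j <- s) f (O :|: F j) + f O.
Proof.
move=> dF; elim: s => [|j s IH] /=; first by rewrite !big_nil setU0 mul0r lexx.
case/andP=> js /IH; rewrite !big_cons -natr1.
have := fsub (O :|: F j) (O :|: \bigcup_(i <- s) F i).
rewrite -setUUr -setUIr.
suff -> : F j :&: \bigcup_(i <- s) F i = set0 by rewrite setU0; lra.
apply/eqP; rewrite setI_eq0; elim: s js {IH} => [|i s IH] /=.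
  by rewrite big_nil => _; rewrite -setI_eq0 setI0.
rewrite inE negb_or big_cons => /andP[ji js].
by rewrite -setI_eq0 setIUr setU_eq0 !setI_eq0 dF //= IH.
Qed.

End Submodular.

(** * The charging argument *)

Section Charging.

Variables (R : realFieldType) (T : finType).
Variables (f : {set T} -> R) (I : {set {set T}}) (k : nat).
Hypotheses (fsub : submodular f) (Iext : k_extendible k I).

Let Isub (A B : {set T}) : A \subset B -> B \in I -> A \in I := Iext.1.2 A B.

(* [D i] is the part of the optimum [O] that can still be added to the i-th
   solution. An element leaving [D i] is charged to the step at which it leaves,
   and every step is charged at most k times: either u \in O leaves the k other
   sets, or u \notin O and k-extendibility evicts at most k elements from one
   set. Protecting [O :&: F j], with [F] the final solutions, from eviction
   excludes that both happen at the same step. *)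
Lemma greedy_run_charging m N (S F D : {ffun 'I_k.+1 -> {set T}}) O :
  greedy_run f I m N S F ->
  (forall i, [disjoint S i & N]) -> (forall i, F i \in I) ->
  (forall i, D i \subset O :&: N) ->
  (forall i, S i :|: D i \in I) ->
  (forall i, F i :&: O \subset S i :|: D i) ->
  \sum_i \sum_(o in D i :\: F i) (f (o |: F i) - f (F i)) <=
    k%:R * \sum_i (f (F i) - f (S i)).
Proof.
move=> runF; elim: runF D => {m N S F}.
  move=> N S stop D dSN SI DN SDI _.
  (* At termination [F] is [S] and the right-hand side vanishes; everything in [D i] is still
     addable, so its marginal is nonpositive. *)
  under [X in _ <= _ * X]eq_bigr do rewrite subrr.
  rewrite big1_eq mulr0; apply: sumr_le0 => i _; apply: sumr_le0 => o.
  rewrite inE => /andP[_ oD]; rewrite subr_le0; apply: stop.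
    by have := subsetP (DN i) o oD; rewrite inE => /andP[].
  by apply: Isub (SDI i); rewrite subUset subsetUl sub1set inE oD orbT.
move=> m N S F u j uN uI u0 umax runF IH D dSN FI DN SDI FD.
set g := f (u |: S j) - f (S j) in u0 umax.
have uS i : u \notin S i.
  by apply/negP => uS; have /pred0P/(_ u) := dSN i; rewrite /= uS uN.
have SF i : S i \subset F i.
  exact: subset_trans (sub_add_to S u j i) (greedy_run_sub runF i).
have uFj : u \in F j.
  by apply: (subsetP (greedy_run_sub runF j)); rewrite add_toE eqxx setU11.
have uF i : i != j -> u \notin F i.
  move=> /negbTE ij; apply/negP => /(subsetP (greedy_run_subU runF i)).
  by rewrite add_toE ij !inE eqxx (negbTE (uS i)).
have dSN' := add_to_disjoint u j dSN.
(* The marginal on [F i] is at most that on [S i], where [o] is still addable and thus loses to the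
   greedy choice. *)
have charge i o : o \in D i :\: F i -> f (o |: F i) - f (F i) <= g.
  rewrite inE => /andP[oF oD].
  apply: le_trans (submodular_marginal fsub (SF i) oF) (umax _ _ _ _).
    by have := subsetP (DN i) o oD; rewrite inE => /andP[].
  by apply: Isub (SDI i); rewrite subUset subsetUl sub1set inE oD orbT.
have gainS : \sum_i (f (F i) - f (S i)) =
    g + \sum_i (f (F i) - f (add_to S u j i)).
  rewrite (bigD1 j) //= [in RHS](bigD1 j) //= add_toE eqxx.
  under [in RHS]eq_bigr => i /negbTE ij do rewrite add_toE ij.
  by rewrite /g; ring.
(* It suffices to shrink [D] to a [D'] that meets the invariant after the step. At most [k]
   departures outside the [F i] are paid for by [g], the rest by induction. *)
suff [D' [D'D evict D'N SD'I FD']] : exists D' : {ffun 'I_k.+1 -> {set T}},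
    [/\ forall i, D' i \subset D i,
        (\sum_i #|(D i :\: D' i) :\: F i| <= k)%N,
        forall i, D' i \subset O :&: (N :\ u),
        forall i, add_to S u j i :|: D' i \in I
      & forall i, F i :&: O \subset add_to S u j i :|: D' i].
  have {IH} := IH D' dSN' FI D'N SD'I FD'; rewrite gainS mulrDr.
  have : \sum_i \sum_(o in (D i :\: D' i) :\: F i) (f (o |: F i) - f (F i))
      <= k%:R * g.
    apply: le_trans (_ : \sum_i #|(D i :\: D' i) :\: F i|%:R * g <= _).
      apply: ler_sum => i _; rewrite mulr_natl -sumr_const; apply: ler_sum => o.
      by rewrite !inE => /and3P[oF _ oD]; apply: charge; rewrite inE oF.
    by rewrite -mulr_suml -natr_sum ler_pM2r // ler_nat.
  move=> le1 le2; apply: le_trans (lerD le1 le2).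
  rewrite -big_split /=; apply: ler_sum => i _.
  rewrite (big_setID (D' i)) /= addrC le_eqVlt; apply/orP; left; apply/eqP.
  congr (_ + _); apply: eq_bigl => o; rewrite !inE.
    by case: (o \in D' i); case: (o \in F i).
  by have := subsetP (D'D i) o; case: (o \in D' i) => [->|_] //; rewrite ?andbT ?andbF.
have [uO|uO] := boolP (u \in O).
  have uDj : u \in D j.
    have : u \in F j :&: O by rewrite inE uFj.
    by move=> /(subsetP (FD j)); rewrite inE (negbTE (uS j)).
  (* For [u] in [O], only [u] leaves. Leaving [D j] is free because [u] lies in [F j], so the other
     [k] indices give at most one charge each. *)
  exists [ffun i => D i :\ u]; split=> [i||i|i|i]; rewrite ?ffunE.
  - exact: subD1set.
  - rewrite (bigD1 j) //= ffunE.
    have -> : #|(D j :\: (D j :\ u)) :\: F j| = 0%N.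
      apply/eqP; rewrite cards_eq0 setD_eq0; apply/subsetP => x.
      by rewrite !inE negb_and negbK; case: eqP => [->|_] //=; case: (x \in D j).
    rewrite add0n; apply: leq_trans (_ : \sum_(i | i != j) 1 <= _)%N.
      apply: leq_sum => i _; rewrite ffunE -(cards1 u); apply/subset_leq_card.
      apply/subsetP => x; rewrite !inE negb_and negbK.
      by case: (x == u); case: (x \in D i); rewrite ?andbF.
    by rewrite sum1_card cardC1 card_ord.
  - by rewrite setIDA; apply/setSD.
  - apply: Isub (SDI i); apply/subsetP => x; rewrite !inE.
    case: (i =P j) => [->|_]; rewrite ?inE.
      by case: eqP => [->|_] //=; rewrite uDj !orbT.
    by case/orP=> [->//|/andP[_ ->]]; rewrite orbT.
  - apply/subsetP => x xF; have := subsetP (FD i) x xF.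
    case: (i =P j) => [->|/eqP ij]; rewrite !inE; first by case: (x == u).
    case: (x =P u) => [xu|_] //=.
    by move: xF; rewrite xu inE (negbTE (uF i ij)).
have uD i : u \notin D i.
  by apply/negP => /(subsetP (DN i)); rewrite inE (negbTE uO).
(* For [u] outside [O], only [D j] changes. The smaller set together with [u] lies in [F j], hence
   is independent, and [Y] avoids both [S j] and the protected part [F j :&: O]. *)
have [||||Y [YS Yk YI]] := Iext.2 (S j :|: F j :&: O) (S j :|: D j) u.
- by rewrite subUset subsetUl FD.
- exact: SDI.
- by rewrite inE negb_or uS uD.
- apply: Isub (FI j); rewrite !subUset sub1set uFj SF /=; exact: subsetIl.
exists [ffun i => if i == j then D i :\: Y else D i]; split=> [i||i|i|i]; rewrite ?ffunE.
- by case: ifP => // _; apply: subsetDl.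
- rewrite (bigD1 j) //= big1 ?addn0 => [|i /negbTE ij]; last first.
    by rewrite ffunE ij setDv set0D cards0.
  rewrite ffunE eqxx; apply: leq_trans Yk; apply/subset_leq_card/subsetP => x.
  by rewrite !inE negb_and negbK; case: (x \in Y); case: (x \in D j); rewrite ?andbF.
- apply: subset_trans (_ : D i \subset _); first by case: ifP => // _; apply: subsetDl.
  apply/subsetP => x xD; have := subsetP (DN i) x xD; rewrite !inE => /andP[-> ->].
  by rewrite andbT; apply/eqP => xu; move: (uD i); rewrite -xu xD.
- case: (i =P j) => [->|_]; last exact: SDI.
  apply: Isub YI; apply/subsetP => x; rewrite !inE.
  have := subsetP YS x; rewrite !inE; case: (x \in Y); last by case: (x == u).
  by move=> /(_ isT); case: (x \in S j); case: (x == u).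
- case: (i =P j) => [->|_]; last exact: FD.
  apply/subsetP => x xF; have := subsetP (FD j) x xF.
  have := subsetP YS x; move: xF; rewrite !inE => /andP[-> ->].
  case: (x \in Y); last by case: (x == u).
  by move=> /(_ isT); rewrite orbT.
Qed.

Lemma greedy_run_union_bound m (F : {ffun 'I_k.+1 -> {set T}}) O :
  nonnegative f -> O \in I ->
  greedy_run f I m [set: T] [ffun _ => set0] F ->
  \sum_i f (O :|: F i) <= (k%:R + 1) * \sum_i f (F i).
Proof.
move=> f0 OI runF.
have I0 : set0 \in I by apply: Isub OI; apply: sub0set.
pose S0 : {ffun 'I_k.+1 -> {set T}} := [ffun _ => set0].
(* Initially all of [O] can be added to each empty solution. *)
pose D : {ffun 'I_k.+1 -> {set T}} := [ffun _ => O].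
have charge : \sum_i \sum_(o in D i :\: F i) (f (o |: F i) - f (F i)) <=
    k%:R * \sum_i (f (F i) - f (S0 i)).
  apply: (greedy_run_charging (O := O) runF) => i.
  - by rewrite ffunE -setI_eq0 set0I.
  - by apply: (greedy_run_indep runF) => i'; rewrite ffunE.
  - by rewrite ffunE setIT.
  - by rewrite !ffunE set0U.
  - by rewrite !ffunE set0U subsetIr.
have marginals : \sum_i (f (O :|: F i) - f (F i)) <=
    \sum_i \sum_(o in D i :\: F i) (f (o |: F i) - f (F i)).
  by apply: ler_sum => i _; rewrite ffunE; apply: submodular_sum_marginals.
(* Nonnegativity discards the terms [f set0]. *)
have drop0 : k%:R * \sum_i (f (F i) - f (S0 i)) <= k%:R * \sum_i f (F i).
  rewrite ler_wpM2l ?ler0n //; apply: ler_sum => i _.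
  by rewrite lerBlDr lerDl f0.
have := le_trans marginals (le_trans charge drop0).
rewrite sumrB; lra.
Qed.

End Charging.

(** * From executions of the whole algorithm to greedy runs *)

Section Algorithm.

Variables (R : realFieldType) (T : finType).
Variables (f : {set T} -> R) (I : {set {set T}}) (l : nat).

Let start : {ffun 'I_l -> {set T}} := [ffun _ => set0].

(** The detour through [omap] and [Some] gives it the shape of the result in [computes_collect]. *)
Definition final_values (F : {ffun 'I_l -> {set T}}) : seq ('I_l * R) :=
  pmap (fun j => omap (pair j) (Some (f (F j)))) (enum 'I_l).

Lemma mem_final_values (F : {ffun 'I_l -> {set T}}) j : (j, f (F j)) \in final_values F.
Proof.
by rewrite /final_values mem_pmap; apply/mapP; exists j; rewrite ?mem_enum.
Qed.

Lemma computes_final_values (F : {ffun 'I_l -> {set T}}) :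
  computes f I
    (collect (fun j => AskValue (F j) (fun v => Ret (Some v))) (enum 'I_l))
    l (final_values F).
Proof.
rewrite -[l in computes _ _ _ l]mul1n -[X in (1 * X)%N]size_enum_ord.
apply: computes_collect => j; split=> [|c b /= [c' -> [-> ->]]] //.
by exists 1%N, 0%N.
Qed.

(** Shows that guarantees about all executions are not vacuous; [0 < l] gives the final [Choose] an
    option. *)
Lemma exec_simultaneous_greedys_exists :
  (0 < l)%N -> exists c S, exec f I (simultaneous_greedys R T l) c S.
Proof.
move=> l0; have [c1 [F loopF]] := exec_greedy_loop_exists f I #|T| setT start.
have [[c2 valsF] _] := computes_final_values F.
have [|j jmax] := @maximizers_neq_nil R _ (final_values F).
  by apply/eqP => vE; have := mem_final_values F (Ordinal l0); rewrite vE.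
exists (c1 + (c2 + 0))%N, (F j); apply/exec_bind; exists F, c1, (c2 + 0)%N.
split=> //; apply/exec_bind; exists (final_values F), c2, 0%N; split=> //.
by exists j.
Qed.

Lemma exec_simultaneous_greedys_run c S :
  exec f I (simultaneous_greedys R T l) c S ->
  exists m F j,
    [/\ greedy_run f I m setT start F, (c <= 3 * (#|T| * l) * m.+1 + l)%N,
        S = F j & forall i, f (F i) <= f S].
Proof.
case/exec_bind=> F [c1 [c2 [-> loopF]]] /exec_bind [vals [c3 [c4 [-> valsP]]]].
have [le_c3 ->] := (computes_final_values F).2 _ _ valsP.
case=> j /mem_maximizers [v jv vmax] [-> ->].
have [|m runF le_c1] := exec_greedy_loop_run _ loopF; first by rewrite cardsT.
exists m, F, j; split=> // [|i].
  by rewrite addn0; apply: leq_add.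
have -> : f (F j) = v.
  move: jv; rewrite /final_values mem_pmap => /mapP [j' _] /= [-> ->] //.
exact: vmax (mem_final_values F i).
Qed.

(** Each step enlarges one of [l] solutions by one element, and all of them stay independent. *)
Lemma greedy_run_steps m (F : {ffun 'I_l -> {set T}}) :
  set0 \in I -> greedy_run f I m setT start F -> (m <= l * rank I)%N.
Proof.
move=> I0 runF.
have FI : forall i, F i \in I.
  by apply: (greedy_run_indep runF) => i; rewrite ffunE.
have <- : (\sum_i #|F i| = m)%N.
  rewrite (greedy_run_card runF) => [|i]; last by rewrite ffunE -setI_eq0 set0I.
  by rewrite big1 ?addn0 // => i _; rewrite ffunE cards0.
rewrite -[l in (l * _)%N]card_ord -sum_nat_const; apply: leq_sum => i _.
by rewrite /rank; apply: (leq_bigmax_cond (F := fun A : {set T} => #|A|)).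
Qed.

End Algorithm.

(** * Oracle complexity and approximation ratios *)

Section Guarantees.

Variables (R : realFieldType) (T : finType).
Variables (f : {set T} -> R) (I : {set {set T}}) (k : nat).
Hypotheses (fsub : submodular f) (f0 : nonnegative f).
Hypotheses (Iext : k_extendible k I) (k0 : (0 < k)%N).

Variables (c : nat) (S : {set T}).
Hypothesis execS : exec f I (simultaneous_greedys R T k.+1) c S.

Let I0 : set0 \in I.
Proof.
by have /set0Pn [A] := Iext.1.1; apply: Iext.1.2; apply: sub0set.
Qed.

Lemma simultaneous_greedys_calls :
  (0 < rank I)%N -> (0 < #|T|)%N -> (c <= 20 * (k ^ 2 * rank I * #|T|))%N.
Proof.
move=> r0 n0; have [m [F [j [runF le_c _ _]]]] := exec_simultaneous_greedys_run execS.
apply: leq_trans le_c _; have := greedy_run_steps I0 runF.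
move: (rank I) (#|T|) r0 n0 => r n r0 n0 le_m.
(* From [m <= k.+1 * r] with [k] and [r] positive. The constant 20 is 3 * 2 * 3 for the scans plus 2
   for the [k.+1] final evaluations. *)
have le_m1 : (m.+1 <= 3 * (k * r))%N by nia.
have le_l : (k.+1 <= 2 * k)%N by lia.
have le1 : (3 * (n * k.+1) * m.+1 <= 3 * (n * (2 * k)) * (3 * (k * r)))%N.
  by rewrite leq_mul // !leq_mul2l le_l orbT.
have le2 : (k <= k ^ 2 * r * n)%N.
  by rewrite -mulnA -mulnn -mulnA leq_pmulr // !muln_gt0 k0 r0.
have -> : (20 * (k ^ 2 * r * n) =
  3 * (n * (2 * k)) * (3 * (k * r)) + 2 * (k ^ 2 * r * n))%N.
  by rewrite -mulnn; ring.
by apply: leq_add le1 _; apply: leq_trans le_l _; rewrite leq_mul2l.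
Qed.

Lemma simultaneous_greedys_indep : S \in I.
Proof.
have [m [F [j [runF _ -> _]]]] := exec_simultaneous_greedys_run execS.
by apply: (greedy_run_indep runF) => i; rewrite ffunE.
Qed.

Lemma simultaneous_greedys_unions O : O \in I ->
  exists F : 'I_k.+1 -> {set T},
    (forall i j, i != j -> [disjoint F i & F j]) /\
    \sum_i f (O :|: F i) <= (k%:R + 1) ^+ 2 * f S.
Proof.
move=> OI; have [m [F [j [runF _ _ Smax]]]] := exec_simultaneous_greedys_run execS.
exists F; split.
  apply: (greedy_run_disjoint runF) => [i|i i' _]; by rewrite !ffunE -setI_eq0 set0I.
apply: le_trans (greedy_run_union_bound fsub Iext f0 OI runF) _.
(* The second factor [k%:R + 1] comes from bounding each of the [k.+1] values [f (F i)] by [f S]. *)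
rewrite expr2 -mulrA ler_wpM2l ?addr_ge0 ?ler0n //.
have -> : (k%:R + 1) * f S = \sum_(i < k.+1) f S.
  by rewrite natr1 mulr_natl sumr_const card_ord.
exact: ler_sum.
Qed.

Lemma simultaneous_greedys_ratio O : O \in I ->
  k%:R / (k%:R + 1) ^+ 2 * f O <= f S.
Proof.
move=> OI; have [F [dF le_sum]] := simultaneous_greedys_unions OI.
have := submodular_disjoint_unions fsub O dF (enum_uniq 'I_k.+1).
rewrite size_enum_ord [\sum_(j <- _) _]big_enum /= -natr1.
(* Of the [k.+1] copies of [f O] one cancels against the right-hand side; nonnegativity removes the
   value of the full union. *)
have := f0 (O :|: \bigcup_(j <- enum 'I_k.+1) F j) => U0 le_O.
rewrite mulrAC ler_pdivrMr; last by rewrite exprn_gt0 // ltr_wpDl ?ler0n.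
by rewrite [f S * _]mulrC; apply: le_trans le_sum; lra.
Qed.

Lemma simultaneous_greedys_monotone_ratio O : monotone f -> O \in I ->
  f O / (k%:R + 1) <= f S.
Proof.
move=> fmono OI; have [F [_ le_sum]] := simultaneous_greedys_unions OI.
have kp : 0 < k%:R + 1 :> R by rewrite ltr_wpDl ?ler0n.
(* Monotonicity keeps all [k.+1] copies of [f O], which cancels one factor [k%:R + 1] of the
   square. *)
rewrite ler_pdivrMr // [f S * _]mulrC -(ler_pM2l kp) mulrA -expr2.
apply: le_trans le_sum.
have -> : (k%:R + 1) * f O = \sum_(i < k.+1) f O.
  by rewrite natr1 mulr_natl sumr_const card_ord.
by apply: ler_sum => i _; apply/fmono/subsetUl.
Qed.

End Guarantees.

Theorem theorem2 :
  (exists C : nat,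
    forall (R : realFieldType) (T : finType) (I : {set {set T}})
           (f : {set T} -> R) (k : nat),
      (0 < k)%N ->
      (forall u : T, [set u] \in I) ->
      k_extendible k I ->
      nonnegative f ->
      submodular f ->
      (exists c S, exec f I (simultaneous_greedys R T k.+1) c S) /\
      (forall (c : nat) (S : {set T}),
        exec f I (simultaneous_greedys R T k.+1) c S ->
        [/\ (0 < #|T|)%N -> (c <= C * (k ^ 2 * rank I * #|T|))%N,
            S \in I,
            forall OPT, is_opt f I OPT ->
              f S >= k%:R / (k%:R + 1) ^+ 2 * f OPT
          & monotone f ->
            forall OPT, is_opt f I OPT -> f S >= f OPT / (k%:R + 1)]))
  /\
  (exists C : nat,
    forall (R : realFieldType) (k : nat), (0 < k)%N ->
      `|(k%:R + 1) ^+ 2 / k%:R - k%:R| <= C%:R :> R).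
Proof.
split.
  exists 20%N => R T I f k k0 I1 Iext f0 fsub; split.
    exact: exec_simultaneous_greedys_exists.
  move=> c S execS; split.
  - move=> n0; apply: (simultaneous_greedys_calls Iext k0 execS) => //.
    (* An independent singleton makes the rank positive. *)
    have /card_gt0P [u _] := n0; rewrite -(cards1 u) /rank.
    exact: (leq_bigmax_cond (F := fun A : {set T} => #|A|)).
  - exact: simultaneous_greedys_indep execS.
  - by move=> O [OI _]; apply: simultaneous_greedys_ratio execS _ OI.
  - by move=> fmono O [OI _]; apply: simultaneous_greedys_monotone_ratio execS _ fmono OI.
(* The difference equals 2 + 1/k, which is at most 3. *)
exists 3%N => R k k0.
have k1 : 1 <= k%:R :> R by rewrite ler1n.
have -> : (k%:R + 1) ^+ 2 / k%:R - k%:R = 2 + k%:R^-1 :> R.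
  by field; rewrite pnatr_eq0 -lt0n.
have kV0 : 0 <= k%:R^-1 :> R by rewrite invr_ge0 ler0n.
have kV1 : k%:R^-1 <= 1 :> R by rewrite invf_le1 // (lt_le_trans ltr01).
rewrite ger0_norm; lra.
Qed.
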